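(* For all $g\in B_3$ and all $u\in\Delta_q$, $\psi(g(u))=g(\psi(u))$; that is, for all $g\in B_3$ the following diagram commutes: the square with horizontal maps $\psi:\Delta_q\to\hat H_q$ (top and bottom) and vertical maps given by the action of $g$ on $\Delta_q$ (left) and on $\hat H_q$ (right).
   Context: Algebras are associative with multiplicative identity $1$. $\mathbb F$ is a field and $q\in\mathbb F$ is nonzero with $q^4\neq 1$. The universal Askey--Wilson algebra $\Delta_q$ is the $\mathbb F$-algebra defined by generators $A,B,C$ and the relations asserting that each of $$A+\frac{qBC-q^{-1}CB}{q^2-q^{-2}},\qquad B+\frac{qCA-q^{-1}AC}{q^2-q^{-2}},\qquad C+\frac{qAB-q^{-1}BA}{q^2-q^{-2}}$$ is central in $\Delta_q$. The central elements $\alpha,\beta,\gamma$ of $\Delta_q$ are obtained by multiplying these three elements, respectively, by $q+q^{-1}$. The universal DAHA of type $(C_1^\vee,C_1)$, denoted $\hat H_q$, is the $\mathbb F$-algebra defined by generators $t_i^{\pm1}$ ($i\in\{0,1,2,3\}$) and relations: (i) $t_it_i^{-1}=t_i^{-1}t_i=1$ for each $i$; (ii) $t_i+t_i^{-1}$ is central for each $i$; (iii) $t_0t_1t_2t_3=q^{-1}$. The map $\psi:\Delta_q\to\hat H_q$ is the unique $\mathbb F$-algebra homomorphism that sends $A\mapsto t_1t_0+(t_1t_0)^{-1}$, $B\mapsto t_3t_0+(t_3t_0)^{-1}$, $C\mapsto t_2t_0+(t_2t_0)^{-1}$. The Artin braid group $B_3$ is defined by generators $\rho,\sigma$ and the relation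 $\rho^3=\sigma^2$; put $\tau=\rho^3=\sigma^2$. $B_3$ acts on $\Delta_q$ as a group of $\mathbb F$-algebra automorphisms such that $\tau(h)=h$ for all $h\in\Delta_q$; $\rho$ sends $A\mapsto B$, $B\mapsto C$, $C\mapsto A$, $\alpha\mapsto\beta$, $\beta\mapsto\gamma$, $\gamma\mapsto\alpha$; and $\sigma$ sends $A\mapsto B$, $B\mapsto A$, $C\mapsto C+\frac{AB-BA}{q-q^{-1}}$, $\alpha\mapsto\beta$, $\beta\mapsto\alpha$, $\gamma\mapsto\gamma$. $B_3$ acts on $\hat H_q$ as a group of $\mathbb F$-algebra automorphisms such that $\tau(h)=t_0^{-1}ht_0$ for all $h\in\hat H_q$; $\rho$ sends $t_0\mapsto t_0$, $t_1\mapsto t_0^{-1}t_3t_0$, $t_2\mapsto t_1$, $t_3\mapsto t_2$; and $\sigma$ sends $t_0\mapsto t_0$, $t_1\mapsto t_0^{-1}t_3t_0$, $t_2\mapsto t_1t_2t_1^{-1}$, $t_3\mapsto t_1$. *)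

(* Defs.v *)
From HB Require Import structures.
From mathcomp Require Import all_boot all_order all_algebra.
From mathcomp Require Import generic_quotient ring_quotient.
From mathcomp Require Import boolp.
From mathcomp Require Import finmap monalg.

Set Implicit Arguments.
Unset Strict Implicit.
Unset Printing Implicit Defensive.

Import GRing.Theory.
Local Open Scope ring_scope.
Local Open Scope quotient_scope.

Notation free_alg F X := {malg F[{fmonom X}]}.

Section TwoSidedIdeal.
Variables (A : nzRingType) (R : A -> Prop).

Inductive ideal_gen : A -> Prop :=
| ideal_gen0 : ideal_gen 0
| ideal_genD a r b x : R r -> ideal_gen x -> ideal_gen (a * r * b + x).

Lemma ideal_gen_add x y : ideal_gen x -> ideal_gen y -> ideal_gen (x + y).
Proof.
by elim=> [|a r b z Rr _ IH] Iy; rewrite ?add0r // -addrA; apply/ideal_genD/IH.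
Qed.

Lemma ideal_gen_mul c x d : ideal_gen x -> ideal_gen (c * x * d).
Proof.
elim=> [|a r b z Rr _ IH]; first by rewrite mulr0 mul0r; apply: ideal_gen0.
have -> : c * (a * r * b + z) * d = c * a * r * (b * d) + c * z * d.
  by rewrite mulrDr mulrDl !mulrA.
exact: ideal_genD.
Qed.

Definition in_ideal : A -> bool := fun x => `[< ideal_gen x >].

Fact in_ideal_zmod_closed : zmod_closed in_ideal.
Proof.
split=> [|x y /asboolP Ix /asboolP Iy]; apply/asboolP; first exact: ideal_gen0.
by apply: ideal_gen_add => //; rewrite -mulN1r -[_ * y]mulr1; apply: ideal_gen_mul.
Qed.

HB.instance Definition _ := GRing.isZmodClosed.Build A in_ideal
  in_ideal_zmod_closed.

Definition ideal_zmod := GRing.ZmodClosed.clone A in_ideal _.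

End TwoSidedIdeal.

(* The locks below only keep unification from unfolding the constructions. *)
Fact fgen_key : unit. Proof. exact: tt. Qed.
Fact free_eval_key : unit. Proof. exact: tt. Qed.

Section FreeAlgebra.
Variables (F : fieldType) (X : choiceType).
Local Notation E := (free_alg F X).

Definition fgen (x : X) : E := locked_with fgen_key << fmu x >>.

Lemma fgenE x : fgen x = << fmu x >>.
Proof. by rewrite /fgen unlock. Qed.

Lemma free_mulCr (c : F) (x : E) : x * c%:MP = c%:MP * x.
Proof.
rewrite !malgM_def fgmulUg fgmulgU.
by apply: eq_bigr => k _; rewrite [in LHS]mulrC mulm1 mul1m.
Qed.

Lemma free_scaleAr (c : F) (x y : E) : c *: (x * y) = x * (c *: y).
Proof.
by rewrite -[LHS]mul_malgC -[c *: y]mul_malgC [LHS]mulrA [RHS]mulrA free_mulCr.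
Qed.

Lemma free_ind (P : E -> Prop) :
    (forall x, P (fgen x)) -> P 1 -> (forall c x, P x -> P (c *: x)) ->
    (forall x y, P x -> P y -> P (x + y)) ->
    (forall x y, P x -> P y -> P (x * y)) -> forall x, P x.
Proof.
move=> Pg P1 PZ PD PM x; rewrite [x]monalgE.
elim/big_ind: _ => //= [|[s] _]; first by rewrite -(scale0r 1); apply: PZ.
have -> c : << c *g FMonom s >> = c *: << FMonom s >> :> E.
  by apply/malgP => k; rewrite [RHS]mcoeffZ 2!mcoeffU mulrnAr mulr1.
apply: PZ; elim: s => [|y s IH]; first by rewrite -fmoneE.
have -> : << FMonom (y :: s) >> = fgen y * << FMonom s >> :> E.
  by rewrite malgM_def fgenE fgmulUU mulr1 /mmul /= fmmulE fmuE.
exact: PM.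
Qed.

Variables (B : algType F) (f : X -> B).

Definition free_mon (m : {fmonom X}) : B := \prod_(x <- m) f x.

Fact free_mon_morph : mmorphism free_mon.
Proof.
by split=> [m1 m2|]; rewrite /free_mon ?fmM ?big_cat // fm1 big_nil.
Qed.

HB.instance Definition _ := monalg.isMultiplicative.Build {fmonom X} B free_mon
  free_mon_morph.

Definition free_eval : E -> B :=
  locked_with free_eval_key (mmap (in_alg B) free_mon).

Lemma free_eval_def : free_eval = mmap (in_alg B) free_mon.
Proof. by rewrite /free_eval unlock. Qed.

Fact free_eval_zmod : zmod_morphism free_eval.
Proof. by rewrite free_eval_def => x y; rewrite raddfB. Qed.

HB.instance Definition _ := GRing.isZmodMorphism.Build E B free_eval
  free_eval_zmod.

Fact free_eval_monoid : monoid_morphism free_eval.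
Proof.
have [] : multiplicative free_eval; last by [].
rewrite free_eval_def.
by apply: commr_mmap_is_multiplicative => g m m';
  rewrite /GRing.comm /= mulr_algl mulr_algr.
Qed.

HB.instance Definition _ := GRing.isMonoidMorphism.Build E B free_eval
  free_eval_monoid.

Fact free_eval_scale : scalable free_eval.
Proof. by move=> c x; rewrite free_eval_def mmapZ /= mulr_algl. Qed.

HB.instance Definition _ := GRing.isScalable.Build F E B *:%R free_eval
  free_eval_scale.

Lemma free_evalE x : free_eval (fgen x) = f x.
Proof. by rewrite free_eval_def fgenE mmapU /= scale1r mul1r /free_mon fmU big_seq1. Qed.

Lemma free_eval_ideal (R : E -> Prop) :
  (forall r, R r -> free_eval r = 0) -> forall x, ideal_gen R x -> free_eval x = 0.
Proof.
move=> fR x; elim=> [|a r b y /fR r0 _ y0]; first exact: rmorph0.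
by rewrite rmorphD !rmorphM /= r0 y0 mulr0 mul0r addr0.
Qed.

Lemma free_eval_nz (R : E -> Prop) :
  (forall r, R r -> free_eval r = 0) -> ~ ideal_gen R 1.
Proof.
by move=> fR /(free_eval_ideal fR)/eqP; rewrite rmorph1 oner_eq0.
Qed.

Lemma free_eval_commutator (x y : E) :
  commutative (@GRing.mul B) -> free_eval (x * y - y * x) = 0.
Proof.
move=> BC; rewrite raddfB -[RHS](subrr (free_eval x * free_eval y)).
congr (_ - _); first exact: free_eval_monoid.2.
by rewrite BC; apply: free_eval_monoid.2.
Qed.

End FreeAlgebra.

Arguments fgen {F X}.

Section QuotientAlgebra.
Variables (F : fieldType) (X : choiceType) (R : free_alg F X -> Prop).

(* The library's algebras are non-trivial rings, so a presentation must come
   with a proof that it does not collapse. *)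
Hypothesis nzR : ~ ideal_gen R 1.

Definition quo_alg of ~ ideal_gen R 1 := Quotient.quot (ideal_zmod R).

Local Notation Q := (quo_alg nzR).

HB.instance Definition _ := GRing.Zmodule.on Q.

Definition quo_pi (x : free_alg F X) : Q := \pi_(Quotient.quot (ideal_zmod R)) x.
Definition quo_repr (u : Q) : free_alg F X :=
  repr (u : Quotient.quot (ideal_zmod R)).

Lemma quo_reprK u : quo_pi (quo_repr u) = u.
Proof. exact: reprK. Qed.

Lemma quo_piP x y : quo_pi x = quo_pi y <-> ideal_gen R (x - y).
Proof.
split=> [/eqP|/asboolP Ixy]; first by rewrite -Quotient.idealrBE => /asboolP.
by apply/eqP; rewrite -Quotient.idealrBE.
Qed.

Lemma quo_piD x y : quo_pi (x + y) = quo_pi x + quo_pi y.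
Proof. by rewrite /quo_pi piE. Qed.

Lemma quo_piN x : quo_pi (- x) = - quo_pi x.
Proof. by rewrite /quo_pi piE. Qed.

Definition quo_one : Q := quo_pi 1.
Definition quo_mul (u v : Q) : Q :=
  (quo_pi (quo_repr u * quo_repr v)).
Definition quo_scale (c : F) (u : Q) : Q :=
  (quo_pi (c *: quo_repr u)).

Lemma ideal_pi_repr x : ideal_gen R (quo_repr (quo_pi x) - x).
Proof. by apply/quo_piP; rewrite quo_reprK. Qed.

Lemma quo_piM x y : quo_pi (x * y) = quo_mul (quo_pi x) (quo_pi y).
Proof.
apply/esym/quo_piP.
set x' := quo_repr _; set y' := quo_repr _.
have -> : x' * y' - x * y = (x' - x) * y' + x * (y' - y).
  by rewrite mulrBl mulrBr addrA subrK.
apply: ideal_gen_add; first by rewrite -[_ - x]mul1r; apply/ideal_gen_mul/ideal_pi_repr.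
by rewrite -[x * _]mulr1; apply/ideal_gen_mul/ideal_pi_repr.
Qed.

Lemma quo_piZ c x : quo_pi (c *: x) = quo_scale c (quo_pi x).
Proof.
apply/esym/quo_piP; rewrite -scalerBr -mul_malgC -[_ * (_ - _)]mulr1.
exact/ideal_gen_mul/ideal_pi_repr.
Qed.

Lemma quo_ind (P : Q -> Prop) : (forall x, P (quo_pi x)) -> forall u, P u.
Proof. by move=> PP u; rewrite -[u]quo_reprK. Qed.

Fact quo_mulA : associative quo_mul.
Proof.
elim/quo_ind=> x; elim/quo_ind=> y; elim/quo_ind=> z.
by rewrite -!quo_piM mulrA.
Qed.

Fact quo_mul1 : left_id quo_one quo_mul.
Proof. by elim/quo_ind=> x; rewrite -quo_piM mul1r. Qed.

Fact quo_mulr1 : right_id quo_one quo_mul.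
Proof. by elim/quo_ind=> x; rewrite -quo_piM mulr1. Qed.

Fact quo_mulDl : left_distributive quo_mul +%R.
Proof.
elim/quo_ind=> x; elim/quo_ind=> y; elim/quo_ind=> z.
by rewrite -!quo_piM -!quo_piD -!quo_piM mulrDl.
Qed.

Fact quo_mulDr : right_distributive quo_mul +%R.
Proof.
elim/quo_ind=> x; elim/quo_ind=> y; elim/quo_ind=> z.
by rewrite -!quo_piM -!quo_piD -!quo_piM mulrDr.
Qed.

Fact quo_one_neq0 : quo_one != 0.
Proof.
have -> : 0 = quo_pi 0 by rewrite /quo_pi piE.
by apply/eqP => /quo_piP; rewrite subr0; apply: nzR.
Qed.

HB.instance Definition _ := GRing.Zmodule_isNzRing.Build Q
  quo_mulA quo_mul1 quo_mulr1 quo_mulDl quo_mulDr quo_one_neq0.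

Fact quo_scalerA a b u : quo_scale a (quo_scale b u) = quo_scale (a * b) u.
Proof. by elim/quo_ind: u => x; rewrite -!quo_piZ scalerA. Qed.

Fact quo_scale1r : left_id 1 quo_scale.
Proof. by elim/quo_ind=> x; rewrite -quo_piZ scale1r. Qed.

Fact quo_scalerDr : right_distributive quo_scale +%R.
Proof.
by move=> c; elim/quo_ind=> x; elim/quo_ind=> y;
  rewrite -!quo_piZ -!quo_piD -!quo_piZ scalerDr.
Qed.

Fact quo_scalerDl u : {morph quo_scale^~ u : a b / a + b}.
Proof.
by move=> a b; elim/quo_ind: u => x; rewrite -!quo_piZ -!quo_piD scalerDl.
Qed.

HB.instance Definition _ := GRing.Zmodule_isLmodule.Build F Q
  quo_scalerA quo_scale1r quo_scalerDr quo_scalerDl.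

Fact quo_scalerAl c (u v : Q) : c *: (u * v) = c *: u * v.
Proof.
elim/quo_ind: u => x; elim/quo_ind: v => y.
by rewrite /GRing.scale /GRing.mul /= -!(quo_piM, quo_piZ) scalerAl.
Qed.

HB.instance Definition _ := GRing.Lmodule_isLalgebra.Build F Q quo_scalerAl.

Fact quo_scalerAr c (u v : Q) : c *: (u * v) = u * (c *: v).
Proof.
elim/quo_ind: u => x; elim/quo_ind: v => y.
by rewrite /GRing.scale /GRing.mul /= -!(quo_piM, quo_piZ) free_scaleAr.
Qed.

HB.instance Definition _ := GRing.Lalgebra_isAlgebra.Build F Q quo_scalerAr.

Fact quo_pi_zmod : zmod_morphism quo_pi.
Proof. by move=> x y; rewrite quo_piD quo_piN. Qed.
HB.instance Definition _ := GRing.isZmodMorphism.Build (free_alg F X) Q quo_pi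
  quo_pi_zmod.
Fact quo_pi_monoid : monoid_morphism quo_pi.
Proof. by split; [exact: erefl | exact: quo_piM]. Qed.
HB.instance Definition _ := GRing.isMonoidMorphism.Build (free_alg F X) Q quo_pi
  quo_pi_monoid.
HB.instance Definition _ := GRing.isScalable.Build F (free_alg F X) Q *:%R
  quo_pi quo_piZ.

End QuotientAlgebra.

(* The quotient of the free algebra by a two-sided ideal, known only through its
   projection. *)
Record quotient_by (F : fieldType) (X : choiceType) (R : free_alg F X -> Prop) :=
  QuotientBy {
    quotient_alg : algType F;
    quotient_pi : {lrmorphism free_alg F X -> quotient_alg};
    quotient_surj : forall u, exists x, quotient_pi x = u;
    quotient_ker : forall x, quotient_pi x = 0 <-> ideal_gen R x
  }.

Section PresentedAlgebra.
Variables (F : fieldType) (X : choiceType) (R : free_alg F X -> Prop).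
Hypothesis nzR : ~ ideal_gen R 1.

Definition pres_quotient : quotient_by R.
Proof.
apply: (@QuotientBy _ _ _ (quo_alg nzR) (@quo_pi F X R nzR)) => [u|x].
  by exists (quo_repr u); apply: quo_reprK.
by rewrite -(rmorph0 (@quo_pi F X R nzR)) quo_piP subr0.
Qed.

Definition pres_alg : algType F := quotient_alg pres_quotient.
Definition pres_pi : {lrmorphism free_alg F X -> pres_alg} :=
  quotient_pi pres_quotient.
Definition pres_gen (x : X) : pres_alg := pres_pi (fgen x).

Lemma pres_ind (P : pres_alg -> Prop) : (forall x, P (pres_pi x)) -> forall u, P u.
Proof. by move=> PP u; have [x <-] := @quotient_surj _ _ _ pres_quotient u. Qed.

Lemma pres_ker x : pres_pi x = 0 <-> ideal_gen R x.
Proof. exact: quotient_ker. Qed.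

Lemma pres_rel r : R r -> pres_pi r = 0.
Proof.
move=> Rr; apply/pres_ker.
by rewrite -[r]addr0 -[r]mulr1 -[r]mul1r; apply/ideal_genD/ideal_gen0.
Qed.

Lemma pres_hom_eq (B : algType F) (g h : {lrmorphism pres_alg -> B}) :
  (forall x, g (pres_gen x) = h (pres_gen x)) -> g =1 h.
Proof.
move=> gh; elim/pres_ind; elim/free_ind => //.
- by rewrite !rmorph1.
- by move=> c x IH; rewrite !linearZ /= IH.
- by move=> x y IHx IHy; rewrite !rmorphD /= IHx IHy.
- by move=> x y IHx IHy; rewrite !rmorphM /= IHx IHy.
Qed.

Lemma pres_universal (B : algType F) (f : X -> B) :
    (forall r, R r -> free_eval f r = 0) ->
  exists h : {lrmorphism pres_alg -> B}, forall x, h (pres_gen x) = f x.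
Proof.
move=> fR; pose h (u : pres_alg) : B :=
  free_eval f (projT1 (cid (@quotient_surj _ _ _ pres_quotient u))).
have hE x : h (pres_pi x) = free_eval f x.
  rewrite /h; case: cid => y /= yx; apply/eqP; rewrite -subr_eq0 -rmorphB.
  apply/eqP/(free_eval_ideal fR)/pres_ker; rewrite rmorphB.
  by apply/eqP; rewrite subr_eq0; apply/eqP/yx.
have hB : zmod_morphism h.
  by elim/pres_ind=> x; elim/pres_ind=> y; rewrite -rmorphB !hE rmorphB.
have hM : monoid_morphism h.
  split; first by rewrite -(rmorph1 pres_pi) hE rmorph1.
  by elim/pres_ind=> x; elim/pres_ind=> y; rewrite -rmorphM !hE rmorphM.
have hZ : scalable h.
  by move=> c; elim/pres_ind=> x; rewrite -linearZ !hE linearZ.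
pose m1 := GRing.isZmodMorphism.Build pres_alg B h hB.
pose m2 := GRing.isMonoidMorphism.Build pres_alg B h hM.
pose m3 := GRing.isScalable.Build F pres_alg B *:%R h hZ.
pose hh : {lrmorphism pres_alg -> B} := HB.pack h m1 m2 m3.
by exists hh => x; rewrite [LHS]hE free_evalE.
Qed.

End PresentedAlgebra.

Section PresentedGroup.
Variable X : choiceType.

(* [(x, false)] stands for the generator [x], [(x, true)] for its inverse. *)
Definition gword : Type := seq (X * bool).

HB.instance Definition _ := Choice.on gword.

Definition gword_inv (w : gword) : gword := rev [seq (p.1, ~~ p.2) | p <- w].

Variable R : gword -> gword -> Prop.

Inductive gword_eqv : gword -> gword -> Prop :=
| gword_refl u : gword_eqv u u
| gword_sym u v : gword_eqv u v -> gword_eqv v u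
| gword_trans u v w : gword_eqv u v -> gword_eqv v w -> gword_eqv u w
| gword_cancel s x b t : gword_eqv (s ++ [:: (x, b), (x, ~~ b) & t]) (s ++ t)
| gword_rel s u v t : R u v -> gword_eqv (s ++ u ++ t) (s ++ v ++ t).

Definition gword_eqb : rel gword := fun u v => `[< gword_eqv u v >].

Fact gword_eqb_equiv : equiv_class_of gword_eqb.
Proof.
split=> [u|u v|v u w]; first exact/asboolP/gword_refl.
  by apply/asboolP/asboolP; apply: gword_sym.
move=> /asboolP uv /asboolP vw; exact/asboolP/(gword_trans uv vw).
Qed.

Canonical gword_equiv := EquivRelPack gword_eqb_equiv.
Canonical gword_enc := defaultEncModRel gword_eqb.

Definition pres_grp := {eq_quot gword_eqb}.

HB.instance Definition _ := Choice.on pres_grp.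

Definition pgrp_pi (w : gword) : pres_grp := \pi_({eq_quot gword_eqb}) w.
Definition pgrp_repr (g : pres_grp) : gword := repr (g : {eq_quot gword_eqb}).
Definition pgrp_gen (x : X) : pres_grp := pgrp_pi [:: (x, false)].

Lemma pgrp_reprK g : pgrp_pi (pgrp_repr g) = g.
Proof. exact: reprK. Qed.

Lemma pgrp_piP u v : pgrp_pi u = pgrp_pi v <-> gword_eqv u v.
Proof.
have uvP := @eqmodP _ (EquivRelPack gword_eqb_equiv) u v.
by split=> [/(introT uvP)/asboolP|/asboolP/(elimT uvP)].
Qed.

Lemma pgrp_pi_ind (P : pres_grp -> Prop) :
  (forall w, P (pgrp_pi w)) -> forall g, P g.
Proof. by move=> PP g; rewrite -[g]pgrp_reprK. Qed.

Definition pgrp_mul g h := pgrp_pi (pgrp_repr g ++ pgrp_repr h).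
Definition pgrp_inv g := pgrp_pi (gword_inv (pgrp_repr g)).
Definition pgrp_one := pgrp_pi [::].

Lemma gword_eqv_cat u u' v v' :
  gword_eqv u u' -> gword_eqv v v' -> gword_eqv (u ++ v) (u' ++ v').
Proof.
move=> uu' vv'; apply: (@gword_trans _ (u' ++ v)).
  elim: uu' => {u u' v' vv'} [u|u w _|u1 u2 u3 _ IH1 _|s x b t|s u w t Ruw].
  - exact: gword_refl.
  - exact: gword_sym.
  - exact: gword_trans.
  - by rewrite -!catA /=; apply: gword_cancel.
  - by rewrite -!catA; apply: gword_rel.
elim: vv' => {v v' uu'} [w|w w' _|u1 u2 u3 _ IH1 _|s x b t|s w w' t Ruw].
- exact: gword_refl.
- exact: gword_sym.
- exact: gword_trans.
- by rewrite !catA; apply: gword_cancel.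
- by rewrite [u' ++ s ++ _]catA [X in gword_eqv _ X]catA; apply: gword_rel.
Qed.

Lemma pgrp_piM u v : pgrp_pi (u ++ v) = pgrp_mul (pgrp_pi u) (pgrp_pi v).
Proof. by apply/pgrp_piP/gword_eqv_cat; apply/pgrp_piP; rewrite pgrp_reprK. Qed.

Fact pgrp_mulA : associative pgrp_mul.
Proof.
elim/pgrp_pi_ind=> u; elim/pgrp_pi_ind=> v; elim/pgrp_pi_ind=> w.
by rewrite -!pgrp_piM catA.
Qed.

Fact pgrp_mul1 : left_id pgrp_one pgrp_mul.
Proof. by elim/pgrp_pi_ind=> u; rewrite -pgrp_piM. Qed.

Fact pgrp_mulr1 : right_id pgrp_one pgrp_mul.
Proof. by elim/pgrp_pi_ind=> u; rewrite -pgrp_piM cats0. Qed.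

Lemma gword_mulV u : gword_eqv (u ++ gword_inv u) [::].
Proof.
elim: u => [|[x b] u IH]; first exact: gword_refl.
rewrite /gword_inv /= rev_cons -cats1 catA -/(gword_inv u).
apply: gword_trans (gword_cancel [::] x b [::]).
apply: (@gword_eqv_cat [:: (x, b)] [:: (x, b)]); first exact: gword_refl.
by apply: (@gword_eqv_cat _ [::]); last exact: gword_refl.
Qed.

Lemma gword_invK : involutive gword_inv.
Proof.
move=> u; rewrite /gword_inv map_rev revK -map_comp -[RHS]map_id.
by apply: eq_map => -[x b] /=; rewrite negbK.
Qed.

Fact pgrp_mulrV : right_inverse pgrp_one pgrp_inv pgrp_mul.
Proof.
by move=> g; rewrite -{1}[g]pgrp_reprK -pgrp_piM; apply/pgrp_piP/gword_mulV.
Qed.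

Fact pgrp_mulVr : left_inverse pgrp_one pgrp_inv pgrp_mul.
Proof.
move=> g; rewrite -{2}[g]pgrp_reprK -pgrp_piM -{2}[pgrp_repr g]gword_invK.
exact/pgrp_piP/gword_mulV.
Qed.

HB.instance Definition _ := isGroup.Build pres_grp
  pgrp_mulA pgrp_mul1 pgrp_mulr1 pgrp_mulVr pgrp_mulrV.

Lemma pgrp_ind (P : pres_grp -> Prop) :
    P 1%g -> (forall g h, P g -> P h -> P (g * h)%g) ->
    (forall g, P g -> P g^-1%g) -> (forall x, P (pgrp_gen x)) ->
  forall g, P g.
Proof.
move=> P1 PM PV Pg; elim/pgrp_pi_ind; elim=> [|[x b] w IH]; first exact: P1.
rewrite -cat1s pgrp_piM; apply: PM => //; case: b; last exact: Pg.
have -> : pgrp_pi [:: (x, true)] = (pgrp_gen x)^-1%g; last exact/PV/Pg.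
apply: (mulgI (pgrp_gen x)); rewrite mulgV -[LHS]pgrp_piM.
exact/pgrp_piP/(@gword_cancel [::] x false [::]).
Qed.

Section Lift.
Variables (G : groupType) (f : X -> G).

Definition gword_eval (w : gword) : G :=
  (\prod_(p <- w) (if p.2 then (f p.1)^-1 else f p.1))%g.

Lemma pgrp_universal :
    (forall u v, R u v -> gword_eval u = gword_eval v) ->
  exists h : UMagmaMorphism.type pres_grp G,
    forall x, h (pgrp_gen x) = f x.
Proof.
move=> fR; have evalP u v : gword_eqv u v -> gword_eval u = gword_eval v.
  elim=> [//|//|? ? ? _ -> _ -> //|s x b t|s {}u {}v t /fR ruv].
    rewrite /gword_eval !big_cat !big_cons /=; congr (_ * _)%g.
    by rewrite mulgA; case: b; rewrite /= ?mulVg ?mulgV mul1g.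
  by move: ruv; rewrite /gword_eval !big_cat /= => ->.
pose h g := gword_eval (pgrp_repr g).
have hE w : h (pgrp_pi w) = gword_eval w.
  by apply/evalP/pgrp_piP; rewrite pgrp_reprK.
have h1 : h 1%g = 1%g by rewrite [LHS]hE /gword_eval big_nil.
have hM : {morph h : x y / (x * y)%g}.
  by move=> x y; rewrite [LHS]hE /gword_eval big_cat.
pose m := isUMagmaMorphism.Build pres_grp G h (conj h1 hM).
pose hh : UMagmaMorphism.type pres_grp G := HB.pack_for (UMagmaMorphism.type pres_grp G) h m.
by exists hh => x; rewrite [LHS]hE /gword_eval big_seq1.
Qed.

End Lift.
End PresentedGroup.

Arguments pgrp_gen {X R} x.

Variant aw_gen := GenA | GenB | GenC.

HB.instance Definition _ := gen_eqMixin aw_gen.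
HB.instance Definition _ := gen_choiceMixin aw_gen.

Section AskeyWilson.
Variables (F : fieldType) (q : F).

Definition aw_expr (A : lalgType F) (x y z : A) : A :=
  x + (q ^+ 2 - q ^- 2)^-1 *: (q *: (y * z) - q^-1 *: (z * y)).

Local Notation E := (free_alg F aw_gen).

Definition aw_free_expr (g : aw_gen) : E :=
  let A := fgen GenA in let B := fgen GenB in let C := fgen GenC in
  match g with
  | GenA => aw_expr A B C
  | GenB => aw_expr B C A
  | GenC => aw_expr C A B
  end.

Variant aw_rel : E -> Prop :=
| AwCentral g z : aw_rel (aw_free_expr g * z - z * aw_free_expr g).

Fact aw_nontrivial : ~ ideal_gen aw_rel 1.
Proof.
apply: (@free_eval_nz _ _ (F^o : algType F) (fun=> 0)) => _ [g z].
exact/free_eval_commutator/(@mulrC F).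
Qed.

Definition awAlg := pres_alg aw_nontrivial.

Definition awA : awAlg := pres_gen aw_nontrivial GenA.
Definition awB : awAlg := pres_gen aw_nontrivial GenB.
Definition awC : awAlg := pres_gen aw_nontrivial GenC.

Definition aw_alpha : awAlg := (q + q^-1) *: aw_expr awA awB awC.
Definition aw_beta : awAlg := (q + q^-1) *: aw_expr awB awC awA.
Definition aw_gamma : awAlg := (q + q^-1) *: aw_expr awC awA awB.

End AskeyWilson.

(* [(i, false)] stands for t_i and [(i, true)] for its inverse. *)
Definition daha_gen : choiceType := ('I_4 * bool)%type.

Section DAHA.
Variables (F : fieldType) (q : F).

Local Notation E := (free_alg F daha_gen).

Definition daha_free_t (i : 'I_4) : E := fgen (i, false).
Definition daha_free_tV (i : 'I_4) : E := fgen (i, true).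

Variant daha_rel : E -> Prop :=
| DahaMulV i : daha_rel (daha_free_t i * daha_free_tV i - 1)
| DahaVMul i : daha_rel (daha_free_tV i * daha_free_t i - 1)
| DahaCentral i z :
    daha_rel ((daha_free_t i + daha_free_tV i) * z
              - z * (daha_free_t i + daha_free_tV i))
| DahaProd : daha_rel (\prod_(i < 4) daha_free_t i - q^-1%:A).

Hypothesis q_neq0 : q != 0.

Fact daha_nontrivial : ~ ideal_gen daha_rel 1.
Proof.
pose f (p : daha_gen) : F^o :=
  if p.1 == ord0 then if p.2 then q else q^-1 else 1.
have fE i b : free_eval f (fgen (i, b)) = f (i, b) by rewrite free_evalE.
apply: (@free_eval_nz _ _ (F^o : algType F) f) => _ [i|i|i z|].
- rewrite rmorphB rmorphM rmorph1 /= !fE /f /=.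
  by case: eqP; rewrite ?mul1r ?mulVf ?subrr.
- rewrite rmorphB rmorphM rmorph1 /= !fE /f /=.
  by case: eqP; rewrite ?mul1r ?mulfV ?subrr.
- exact/free_eval_commutator/(@mulrC F).
rewrite rmorphB rmorph_prod !big_ord_recl big_ord0 /= !fE /f /= !mulr1.
by rewrite linearZ rmorph1 /= /GRing.scale /= mulr1 subrr.
Qed.

End DAHA.

Definition dahaAlg (F : fieldType) (q : F) (q_neq0 : q != 0) :=
  pres_alg (daha_nontrivial q_neq0).

Section DAHAElements.
Variables (F : fieldType) (q : F) (q_neq0 : q != 0).
Local Notation H := (dahaAlg q_neq0).

Definition daha_t (i : 'I_4) : H :=
  pres_gen (daha_nontrivial q_neq0) (i, false).
Definition daha_tV (i : 'I_4) : H :=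
  pres_gen (daha_nontrivial q_neq0) (i, true).

Lemma daha_mulV i : daha_t i * daha_tV i = 1.
Proof.
apply/eqP; rewrite -subr_eq0; apply/eqP.
by have := pres_rel (daha_nontrivial q_neq0) (DahaMulV q i);
   rewrite rmorphB rmorphM rmorph1.
Qed.

Lemma daha_Vmul i : daha_tV i * daha_t i = 1.
Proof.
apply/eqP; rewrite -subr_eq0; apply/eqP.
by have := pres_rel (daha_nontrivial q_neq0) (DahaVMul q i);
   rewrite rmorphB rmorphM rmorph1.
Qed.

(* t_i t_j + (t_i t_j)^-1; see daha_ttV for the inverse. *)
Definition daha_tt (i j : 'I_4) : H :=
  daha_t i * daha_t j + daha_tV j * daha_tV i.

Lemma daha_ttV i j :
  (daha_t i * daha_t j) * (daha_tV j * daha_tV i) = 1 /\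
  (daha_tV j * daha_tV i) * (daha_t i * daha_t j) = 1.
Proof.
split; rewrite mulrA.
  by rewrite -(mulrA (daha_t i)) daha_mulV mulr1 daha_mulV.
by rewrite -(mulrA (daha_tV j)) daha_Vmul mulr1 daha_Vmul.
Qed.

End DAHAElements.

Definition i0 : 'I_4 := @Ordinal 4 0 isT.
Definition i1 : 'I_4 := @Ordinal 4 1 isT.
Definition i2 : 'I_4 := @Ordinal 4 2 isT.
Definition i3 : 'I_4 := @Ordinal 4 3 isT.

Record is_psi (F : fieldType) (q : F) (q_neq0 : q != 0)
    (psi : {lrmorphism awAlg q -> dahaAlg q_neq0}) : Prop := IsPsi {
  psiA : psi (awA q) = daha_tt q_neq0 i1 i0;
  psiB : psi (awB q) = daha_tt q_neq0 i3 i0;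
  psiC : psi (awC q) = daha_tt q_neq0 i2 i0
}.

Variant braid3_gen := GenRho | GenSigma.

HB.instance Definition _ := gen_eqMixin braid3_gen.
HB.instance Definition _ := gen_choiceMixin braid3_gen.

Variant braid3_rel : gword braid3_gen -> gword braid3_gen -> Prop :=
| Braid3Rel :
    braid3_rel (nseq 3 (GenRho, false)) (nseq 2 (GenSigma, false)).

Definition braid3 := pres_grp braid3_rel.
HB.instance Definition _ := Group.on braid3.

Definition rho : braid3 := pgrp_gen GenRho.
Definition sigma : braid3 := pgrp_gen GenSigma.
Definition tau : braid3 := (rho ^+ 3)%g.

Lemma tauE : tau = (sigma ^+ 2)%g.
Proof.
have /pgrp_piP := @gword_rel _ braid3_rel [::] _ _ [::] Braid3Rel.
rewrite !cats0 (pgrp_piM _ [:: _] [:: _; _]) (pgrp_piM _ [:: _] [:: _]).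
by rewrite (pgrp_piM _ [:: _] [:: _]).
Qed.

(* Left actions by algebra endomorphisms; each [act g] is an automorphism, with
   inverse [act g^-1]. *)
Record alg_action (F : fieldType) (G : groupType) (A : algType F) := AlgAction {
  act :> G -> {lrmorphism A -> A};
  act1 : forall u, act 1%g u = u;
  actM : forall g h u, act (g * h)%g u = act g (act h u)
}.

Record is_braid3_aw_action (F : fieldType) (q : F)
    (a : alg_action braid3 (awAlg q)) : Prop := {
  aw_tau u : a tau u = u;
  aw_rhoA : a rho (awA q) = awB q;
  aw_rhoB : a rho (awB q) = awC q;
  aw_rhoC : a rho (awC q) = awA q;
  aw_rho_alpha : a rho (aw_alpha q) = aw_beta q;
  aw_rho_beta : a rho (aw_beta q) = aw_gamma q;
  aw_rho_gamma : a rho (aw_gamma q) = aw_alpha q;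
  aw_sigmaA : a sigma (awA q) = awB q;
  aw_sigmaB : a sigma (awB q) = awA q;
  aw_sigmaC : a sigma (awC q) =
    awC q + (q - q^-1)^-1 *: (awA q * awB q - awB q * awA q);
  aw_sigma_alpha : a sigma (aw_alpha q) = aw_beta q;
  aw_sigma_beta : a sigma (aw_beta q) = aw_alpha q;
  aw_sigma_gamma : a sigma (aw_gamma q) = aw_gamma q
}.

Record is_braid3_daha_action (F : fieldType) (q : F) (q_neq0 : q != 0)
    (a : alg_action braid3 (dahaAlg q_neq0)) : Prop := {
  daha_tau u : a tau u = daha_tV q_neq0 i0 * u * daha_t q_neq0 i0;
  daha_rho0 : a rho (daha_t q_neq0 i0) = daha_t q_neq0 i0;
  daha_rho1 : a rho (daha_t q_neq0 i1) =
    daha_tV q_neq0 i0 * daha_t q_neq0 i3 * daha_t q_neq0 i0;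
  daha_rho2 : a rho (daha_t q_neq0 i2) = daha_t q_neq0 i1;
  daha_rho3 : a rho (daha_t q_neq0 i3) = daha_t q_neq0 i2;
  daha_sigma0 : a sigma (daha_t q_neq0 i0) = daha_t q_neq0 i0;
  daha_sigma1 : a sigma (daha_t q_neq0 i1) =
    daha_tV q_neq0 i0 * daha_t q_neq0 i3 * daha_t q_neq0 i0;
  daha_sigma2 : a sigma (daha_t q_neq0 i2) =
    daha_t q_neq0 i1 * daha_t q_neq0 i2 * daha_tV q_neq0 i1;
  daha_sigma3 : a sigma (daha_t q_neq0 i3) = daha_t q_neq0 i1
}.

(* Main.v *)
Require Import Defs.
From mathcomp Require Import all_boot all_order all_algebra.
From mathcomp Require Import monalg.

(** Both sides of [psi (aD g u) = aH g (psi u)] are algebra morphisms in [u] and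
    compatible with products and inverses in [g], so only [g = rho], [g = sigma]
    and [u = A, B, C] matter.  Write [s_i] for the inverse of [t_i],
    [T_i = t_i + s_i], and [A], [B], [C] also for the images
    [t_i t_0 + (t_i t_0)^-1], [i = 1, 3, 2], in the double affine Hecke algebra.

    The three cases for [rho], and [sigma] on [A] and [B], follow from the fact
    that [t_i t_0 + (t_i t_0)^-1] commutes with [t_0] ([fam_tt_conj]), which
    absorbs the conjugations by [t_0] in the action.

    The case of [sigma] and [C] is the substantial one: with [C' = sigma C], it
    asks for [A B - B A = (q - q^-1) (C' - C)] ([fam_C'E]).  The relation
    - [B A + q^-1 C + q C' = T_1 T_3 + T_2 (q^-1 t_0 + q s_0)]
    ([fam_BA_relation]) is a direct computation from [t_0 t_1 t_2 t_3 = q^-1].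
    Its right-hand side is fixed by [sigma], which exchanges [T_1] and [T_3],
    central elements, and fixes [T_2], [t_0] and [s_0].
    On the left, [sigma] exchanges [A] and [B], and also [C] and [C'], because
    [sigma^2 = tau] is conjugation by [t_0], which fixes [C].  Hence
    - [A B + q^-1 C' + q C = B A + q^-1 C + q C'],
    and moving [C] and [C'] to one side gives the desired identity. *)

Set Implicit Arguments.
Unset Strict Implicit.
Unset Printing Implicit Defensive.

Import GRing.Theory.
Local Open Scope ring_scope.

(** * From a presentation to its relations *)

Section PresentationRelations.
Variables (F : fieldType) (X : choiceType) (R : free_alg F X -> Prop).
Variable nzR : ~ ideal_gen R 1.
Local Notation pi := (pres_pi nzR).

Lemma pres_rel_eq x y : R (x - y) -> pi x = pi y.
Proof. by move/(pres_rel nzR)/eqP; rewrite rmorphB subr_eq0 => /eqP. Qed.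

Lemma pres_rel_central x y :
    (forall z, R ((x + y) * z - z * (x + y))) ->
  forall z, GRing.comm (pi x + pi y) z.
Proof.
move=> Rxy; elim/pres_ind=> z; rewrite /GRing.comm -rmorphD -!rmorphM.
exact/pres_rel_eq/Rxy.
Qed.

Lemma pres_rel_prod4 (x : 'I_4 -> free_alg F X) c :
    R (\prod_(i < 4) x i - c%:A) ->
  pi (x i0) * pi (x i1) * pi (x i2) * pi (x i3) = c%:A.
Proof.
move/pres_rel_eq.
have -> : pi c%:A = c%:A by rewrite linearZ rmorph1.
move<-; rewrite rmorph_prod !big_ord_recl big_ord0 mulr1 !mulrA.
by congr (pi (x _) * pi (x _) * pi (x _) * pi (x _)); apply/val_inj.
Qed.

End PresentationRelations.

(** The defining relations alone: the computations below hold for any such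
    elements of any algebra, whether or not they satisfy further relations. *)
Record daha_family (F : fieldType) (q : F) (A : algType F) (t s : 'I_4 -> A) :
    Prop := DahaFamily {
  fam_mulV : forall i, t i * s i = 1;
  fam_Vmul : forall i, s i * t i = 1;
  fam_central : forall i z, GRing.comm (t i + s i) z;
  fam_prod : t i0 * t i1 * t i2 * t i3 = q^-1%:A
}.

Lemma daha_family_gen (F : fieldType) (q : F) (q_neq0 : q != 0) :
  daha_family q (daha_t q_neq0) (daha_tV q_neq0).
Proof.
split.
- exact: daha_mulV.
- exact: daha_Vmul.
- by move=> i; apply: pres_rel_central; apply: DahaCentral.
- exact: (pres_rel_prod4 (daha_nontrivial q_neq0) (DahaProd q)).
Qed.

(** * Relations between the [t_i] *)

(** With [x'] and [y'] the inverses of [x] and [y], this says that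
    [x y + (x y)^-1 = y x + (y x)^-1].  Both [x y - x' y'] and [y x - y' x']
    equal [x (y + y') - (x + x') y'], as the two sums are central. *)
Lemma mul_add_inv_swap (R : pzRingType) (x x' y y' : R) :
    (forall z, GRing.comm (x + x') z) -> (forall z, GRing.comm (y + y') z) ->
  x * y + y' * x' = y * x + x' * y'.
Proof.
move=> cx cy.
have e1 : x * y + x * y' = y * x + y' * x by rewrite -mulrDr -cy mulrDl.
have e2 : y' * x + y' * x' = x * y' + x' * y' by rewrite -mulrDr -cx mulrDl.
apply: (addIr (x * y' + y' * x)).
rewrite addrACA e1 [y' * x' + _]addrC e2 [x * y' + y' * x]addrC.
by rewrite [x * y' + x' * y']addrC addrACA.
Qed.

Section DAHAFamily.
Variables (F : fieldType) (q : F) (q_neq0 : q != 0).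
Variables (A : algType F) (t s : 'I_4 -> A) (tsP : daha_family q t s).
Local Notation T i := (t i + s i).
Let tV := fam_mulV tsP.
Let Vt := fam_Vmul tsP.
Let Tz := fam_central tsP.

Definition fam_tt i j : A := t i * t j + s j * s i.
Local Notation tt := fam_tt.

Lemma fam_t012 : t i0 * t i1 * t i2 = q^-1 *: s i3.
Proof.
by rewrite -[LHS]mulr1 -(tV i3) mulrA (fam_prod tsP) mulr_algl.
Qed.

Lemma fam_t301 : t i3 * t i0 * t i1 = q^-1 *: s i2.
Proof.
rewrite -[LHS]mulr1 -(tV i2) !mulrA -(mulrA (t i3) (t i0)).
by rewrite -(mulrA (t i3) _ (t i2)) fam_t012 -scalerAr tV mulr_algl.
Qed.

Lemma fam_s03 : s i0 * s i3 = q *: (t i1 * t i2).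
Proof.
have -> : s i3 = q *: (t i0 * t i1 * t i2).
  by rewrite fam_t012 scalerA divff // scale1r.
by rewrite -scalerAr !mulrA Vt mul1r.
Qed.

Lemma fam_ttC i j : tt i j = t j * t i + s i * s j.
Proof. by apply: mul_add_inv_swap; apply: Tz. Qed.

(** This is the commutation of [tt i j] with [t j]: the conjugate of
    [t_i t_j + (t_i t_j)^-1] by [t_j] is [t_j t_i + (t_j t_i)^-1]. *)
Lemma fam_tt_conj i j : s j * tt i j * t j = tt i j.
Proof.
rewrite {1}fam_ttC mulrDr mulrDl mulrA Vt mul1r.
by rewrite -!mulrA Vt mulr1.
Qed.

(** The image of [tt i2 i0] under [sigma] (see [sigma_tt20]). *)
Definition fam_C' : A :=
  t i1 * t i2 * s i1 * t i0 + s i0 * (t i1 * s i2 * s i1).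

(** Writing [B = t_3 t_0 + s_0 s_3], each half is multiplied by the form of [A]
    that fits it: [t_3 t_0] by [t_1 t_0 + s_0 s_1], since [t_3 t_0 t_1] is a
    multiple of [s_2], and [s_0 s_3] by [t_0 t_1 + s_1 s_0], since [s_0 s_3] is
    a multiple of [t_1 t_2].  Adding [q^-1 t_2 t_0], [q^-1 s_0 s_2] and [q C']
    gives [q^-1 T_2 t_0 + t_3 s_1], [T_3 t_1] and [q T_2 s_0 + s_3 s_1], and
    [t_3 s_1 + s_3 s_1 + T_3 t_1 = T_3 T_1]. *)
Lemma fam_BA_relation :
  tt i3 i0 * tt i1 i0 + (q^-1 *: tt i2 i0 + q *: fam_C') =
  T i1 * T i3 + T i2 * (q^-1 *: t i0 + q *: s i0).
Proof.
pose w := t i1 * t i2 * s i1.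
have t30A : t i3 * t i0 * tt i1 i0 + q^-1 *: (t i2 * t i0) =
    q^-1 *: (T i2 * t i0) + t i3 * s i1.
  rewrite mulrDr mulrA fam_t301 mulrA -(mulrA (t i3)) tV mulr1.
  by rewrite addrAC -scalerAl -scalerDr -mulrDl [s i2 + _]addrC.
have s03X : s i0 * s i3 * (t i0 * t i1) + q^-1 *: (s i0 * s i2) = T i3 * t i1.
  rewrite scalerAr -fam_t301 -!mulrA -mulrDr -mulrDl [s i3 + _]addrC.
  by rewrite [X in s i0 * X]Tz [RHS]Tz !mulrA Vt mul1r.
have wT : w + t i1 * s i2 * s i1 = T i2.
  by rewrite -mulrDl -mulrDr -Tz -mulrA tV mulr1.
have s03Y : s i0 * s i3 * (s i1 * s i0) + q *: fam_C' =
    q *: (T i2 * s i0) + s i3 * s i1.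
  rewrite fam_s03 -scalerAl -scalerDr mulrA -/w /fam_C' -/w addrA -mulrDr.
  rewrite [s i0 + _]addrC -Tz mulrDl -addrA -mulrDr wT addrC.
  rewrite scalerDr -Tz; congr (_ + _).
  by rewrite /w !mulrA scalerAl fam_t012 scalerA divff // scale1r.
rewrite [tt i3 i0]/fam_tt mulrDl.
rewrite [X in _ + X + _](_ : _ = s i0 * s i3 * (t i0 * t i1) +
    s i0 * s i3 * (s i1 * s i0)); last by rewrite fam_ttC mulrDr.
rewrite [tt i2 i0]/fam_tt scalerDr -(addrA (q^-1 *: (t i2 * t i0))).
rewrite addrACA t30A [X in _ + X = _]addrACA s03X s03Y.
rewrite [X in _ + X = _]addrCA addrACA [X in _ + X = _]addrCA -mulrDl.
by rewrite -mulrDr [T i3 * _]Tz [RHS]addrC [X in _ = X + _]mulrDr -!scalerAr.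
Qed.

(** * The action of [sigma] *)

Lemma rmorph_fam_tV (f : {lrmorphism A -> A}) i x x' :
  f (t i) = x -> x' * x = 1 -> f (s i) = x'.
Proof.
move=> fx x'x.
by rewrite -[f _]mul1r -x'x -mulrA -fx -rmorphM tV rmorph1 mulr1.
Qed.

Lemma rmorph_fam_tt (f : {lrmorphism A -> A}) i j x x' y y' :
    f (t i) = x -> x' * x = 1 -> f (t j) = y -> y' * y = 1 ->
  f (tt i j) = x * y + y' * x'.
Proof.
move=> fi x'x fj y'y; rewrite rmorphD !rmorphM /= fi fj.
by rewrite (rmorph_fam_tV fi x'x) (rmorph_fam_tV fj y'y).
Qed.

Lemma fam_t3_conj_inv : s i0 * s i3 * t i0 * (s i0 * t i3 * t i0) = 1.
Proof.
rewrite !mulrA -(mulrA (s i0 * s i3)) tV mulr1 -(mulrA (s i0)).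
by rewrite Vt mulr1 Vt.
Qed.

Lemma fam_t2_conj_inv : t i1 * s i2 * s i1 * (t i1 * t i2 * s i1) = 1.
Proof.
rewrite !mulrA -(mulrA (t i1 * s i2)) Vt mulr1 -(mulrA (t i1)).
by rewrite Vt mulr1 tV.
Qed.

(** Stated for any [f] because it serves both [rho] and [sigma], which agree on
    [t_0] and [t_1]. *)
Lemma rmorph_fam_tt10 (f : {lrmorphism A -> A}) :
    f (t i0) = t i0 -> f (t i1) = s i0 * t i3 * t i0 ->
  f (tt i1 i0) = tt i3 i0.
Proof.
move=> f0 f1.
rewrite (rmorph_fam_tt f1 fam_t3_conj_inv f0 (Vt _)).
by rewrite -[RHS]fam_tt_conj mulrDr mulrDl !mulrA.
Qed.

(** Below, [f] stands for the action of [sigma]; [ff] comes from [sigma^2 = tau]. *)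
Section Sigma.
Variable f : {lrmorphism A -> A}.
Hypothesis f0 : f (t i0) = t i0.
Hypothesis f1 : f (t i1) = s i0 * t i3 * t i0.
Hypothesis f2 : f (t i2) = t i1 * t i2 * s i1.
Hypothesis f3 : f (t i3) = t i1.
Hypothesis ff : forall u, f (f u) = s i0 * u * t i0.

Lemma sigma_tt30 : f (tt i3 i0) = tt i1 i0.
Proof. exact: rmorph_fam_tt f3 (Vt _) f0 (Vt _). Qed.

Lemma sigma_tt20 : f (tt i2 i0) = fam_C'.
Proof. exact: rmorph_fam_tt f2 fam_t2_conj_inv f0 (Vt _). Qed.

Lemma sigma_C' : f fam_C' = tt i2 i0.
Proof. by rewrite -sigma_tt20 ff fam_tt_conj. Qed.

Lemma sigma_T1 : f (T i1) = T i3.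
Proof.
rewrite rmorphD /= f1 (rmorph_fam_tV f1 fam_t3_conj_inv) -mulrDl -mulrDr.
by rewrite -Tz -mulrA Vt mulr1.
Qed.

Lemma sigma_T2 : f (T i2) = T i2.
Proof.
rewrite rmorphD /= f2 (rmorph_fam_tV f2 fam_t2_conj_inv) -mulrDl -mulrDr.
by rewrite -Tz -mulrA tV mulr1.
Qed.

Lemma sigma_T3 : f (T i3) = T i1.
Proof. by rewrite rmorphD /= f3 (rmorph_fam_tV f3 (Vt _)). Qed.

(** This comes from applying [f] to [fam_BA_relation], whose right-hand side it
    fixes. *)
Lemma fam_AB_relation :
  tt i1 i0 * tt i3 i0 + (q^-1 *: fam_C' + q *: tt i2 i0) =
  tt i3 i0 * tt i1 i0 + (q^-1 *: tt i2 i0 + q *: fam_C').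
Proof.
have fR : f (T i1 * T i3 + T i2 * (q^-1 *: t i0 + q *: s i0)) =
    T i1 * T i3 + T i2 * (q^-1 *: t i0 + q *: s i0).
  rewrite rmorphD /= !rmorphM /= sigma_T1 sigma_T2 sigma_T3 -Tz.
  by rewrite linearD !linearZ /= f0 (rmorph_fam_tV f0 (Vt _)).
rewrite [RHS]fam_BA_relation -fR -fam_BA_relation.
rewrite rmorphD /= rmorphM /= linearP linearZ /=.
by rewrite sigma_tt30 (rmorph_fam_tt10 f0 f1) sigma_tt20 sigma_C'.
Qed.

Hypothesis q4_neq1 : q ^+ 4 != 1.

Lemma fam_C'E :
  fam_C' = tt i2 i0 +
    (q - q^-1)^-1 *: (tt i1 i0 * tt i3 i0 - tt i3 i0 * tt i1 i0).
Proof.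
have q_qV : q - q^-1 != 0.
  apply: contraNneq q4_neq1 => /eqP; rewrite subr_eq0 => /eqP qE.
  have q2 : q ^+ 2 = 1 by rewrite expr2 {2}qE divff.
  by rewrite (exprM q 2 2) q2 expr1n.
have := fam_AB_relation.
move: fam_C' (tt i2 i0) (tt i1 i0 * tt i3 i0) (tt i3 i0 * tt i1 i0).
move=> C' C AB BA rel.
have -> : AB - BA = (q - q^-1) *: (C' - C).
  apply/eqP; rewrite subr_eq -(addrK (q^-1 *: C' + q *: C) AB) rel.
  rewrite eq_sym addrC -addrA; apply/eqP; congr (_ + _).
  rewrite scalerBl !scalerBr opprB addrACA [- _ - _]addrC -opprD.
  by rewrite [_ + q *: C']addrC.
by rewrite scalerA mulVf // scale1r addrC subrK.
Qed.

End Sigma.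
End DAHAFamily.

(** * Equivariance *)

Section Equivariance.
Variables (F : fieldType) (q : F) (q_neq0 : q != 0).
Hypothesis q4_neq1 : q ^+ 4 != 1.
Variables (psi : {lrmorphism awAlg q -> dahaAlg q_neq0}) (psiP : is_psi psi).
Variables (aD : alg_action braid3 (awAlg q)) (aDP : is_braid3_aw_action aD).
Variables (aH : alg_action braid3 (dahaAlg q_neq0))
  (aHP : is_braid3_daha_action aH).
Let tsP := daha_family_gen q_neq0.

Lemma aw_hom_eq (B : algType F) (f g : {lrmorphism awAlg q -> B}) :
    f (awA q) = g (awA q) -> f (awB q) = g (awB q) -> f (awC q) = g (awC q) ->
  f =1 g.
Proof. by move=> fA fB fC; apply: pres_hom_eq => -[]. Qed.

Lemma psi_rho u : psi (aD rho u) = aH rho (psi u).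
Proof.
apply: (@aw_hom_eq _ (psi \o aD rho) (aH rho \o psi)) => /=.
- rewrite (aw_rhoA aDP) (psiA psiP) (psiB psiP).
  exact/esym/(rmorph_fam_tt10 tsP (daha_rho0 aHP) (daha_rho1 aHP)).
- rewrite (aw_rhoB aDP) (psiB psiP) (psiC psiP); apply/esym.
  exact: (rmorph_fam_tt tsP (daha_rho3 aHP) (daha_Vmul _ _) (daha_rho0 aHP)
    (daha_Vmul _ _)).
rewrite (aw_rhoC aDP) (psiC psiP) (psiA psiP); apply/esym.
exact: (rmorph_fam_tt tsP (daha_rho2 aHP) (daha_Vmul _ _) (daha_rho0 aHP)
  (daha_Vmul _ _)).
Qed.

Lemma psi_sigma u : psi (aD sigma u) = aH sigma (psi u).
Proof.
have ff v : aH sigma (aH sigma v) = daha_tV q_neq0 i0 * v * daha_t q_neq0 i0.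
  by rewrite -actM -(daha_tau aHP) tauE.
apply: (@aw_hom_eq _ (psi \o aD sigma) (aH sigma \o psi)) => /=.
- rewrite (aw_sigmaA aDP) (psiA psiP) (psiB psiP).
  exact/esym/(rmorph_fam_tt10 tsP (daha_sigma0 aHP) (daha_sigma1 aHP)).
- rewrite (aw_sigmaB aDP) (psiA psiP) (psiB psiP).
  exact/esym/(sigma_tt30 tsP (daha_sigma0 aHP) (daha_sigma3 aHP)).
have psi_sC : psi (aD sigma (awC q)) = daha_tt q_neq0 i2 i0 + (q - q^-1)^-1 *:
    (daha_tt q_neq0 i1 i0 * daha_tt q_neq0 i3 i0
     - daha_tt q_neq0 i3 i0 * daha_tt q_neq0 i1 i0).
  rewrite (aw_sigmaC aDP) rmorphD /= linearZ /= rmorphB /= !rmorphM /=.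
  by rewrite (psiA psiP) (psiB psiP) (psiC psiP).
rewrite psi_sC (psiC psiP).
have := sigma_tt20 tsP (daha_sigma0 aHP) (daha_sigma2 aHP).
rewrite (fam_C'E q_neq0 tsP (daha_sigma0 aHP) (daha_sigma1 aHP)
  (daha_sigma2 aHP) (daha_sigma3 aHP) ff q4_neq1).
by move=> fC; apply/esym.
Qed.

End Equivariance.

Theorem theorem4p2 (F : fieldType) (q : F) (q_neq0 : q != 0)
  (q4_neq1 : q ^+ 4 != 1)
  (psi : {lrmorphism awAlg q -> dahaAlg q_neq0}) (psiP : is_psi psi)
  (aD : alg_action braid3 (awAlg q)) (aDP : is_braid3_aw_action aD)
  (aH : alg_action braid3 (dahaAlg q_neq0)) (aHP : is_braid3_daha_action aH) :
  forall (g : braid3) (u : awAlg q), psi (aD g u) = aH g (psi u).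
Proof.
elim/pgrp_ind=> [u|g h IHg IHh u|g IHg u|[] u].
- by rewrite !act1.
- by rewrite !actM IHg IHh.
- rewrite -[LHS](act1 aH) -(mulVg g) actM -IHg -actM mulgV.
  by rewrite act1.
- exact: psi_rho.
- exact: psi_sigma.
Qed.
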